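(* Let $\delta_{\mathrm{opt}}$ denote the supremum of the densities of all lattice-like cylinder packings of $\mathbf{Sol}$ related to fundamental lattices $\Gamma(t_1^1,t_1^2,N)$, taken over all real $t_1^1,t_1^2\ne0$, all integers $N\ge3$ and all admissible radii $r>0$. Let $\delta(t_1^1,t_1^2,N)$ denote the largest density of such a packing for the given lattice $\Gamma(t_1^1,t_1^2,N)$, i.e. the maximum over admissible $r$. Then $$0.906900\approx\frac{\pi}{\sqrt{12}}\ \ge\ \delta_{\mathrm{opt}}\ \ge\ \delta\Big(1,\,-\tfrac12+\tfrac{\sqrt5}{2},\,3\Big)=-\frac{(-5+\sqrt5)\,\pi\sqrt5}{20\sqrt5-20}\approx 0.78540 .$$
   Context: $\mathbf{Sol}$ is $\mathbb R^3$ with the group law $(a,b,c)(x,y,z)=(x+ae^{-z},\,y+be^{z},\,z+c)$, and translations act on points by right multiplication. The invariant metric is $ds^2=e^{2z}dx^2+e^{-2z}dy^2+dz^2$, so that volume is the Lebesgue measure $dx\,dy\,dz$. The plane $z=0$ is called the base plane. Fundamental lattice: for real $t_1^1,t_1^2\ne0$ and an integer $N\ge3$, put $h=\log\frac{N+\sqrt{N^2-4}}{2}$. Then $\Gamma(t_1^1,t_1^2,N)$ is the subgroup generated by $\tau_1=(t_1^1,t_1^2,0)$, $\tau_2=(t_1^1e^{-h},t_1^2e^{h},0)$, $\tau_3=(0,0,h)$. Let $\Gamma^0=\{m\tau_1+n\tau_2: m,n\in\mathbb Z\}$ be its sublattice in the base plane. The fundamental parallelepiped $\mathcal P$ has base parallelogram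 $\mathcal P^b$ spanned by $\tau_1,\tau_2$, of area $|t_1^1t_1^2(e^h-e^{-h})|$, and $\mathrm{Vol}(\mathcal P)=h\cdot\mathrm{Area}(\mathcal P^b)$. Cylinders: $\mathcal C^i(r)=\{(x,y,z): x^2+y^2\le r^2\}$ is the infinite circular cylinder of radius $r$. It is bounded by the translation curves in the direction of the $z$-axis (vertical lines) through the points of the circle of radius $r$ about the origin in the base plane. For $\tau=(x^1,x^2,0)$, its translate $\mathcal C^i_\tau(r)$ is the vertical cylinder of radius $r$ over the disk centred at $(x^1,x^2)$. The bounded cylinder $\mathcal C(r,h)$ is the part $0\le z\le h$ of $\mathcal C^i(r)$, with base disk $\mathcal C^b(r)$ and volume $\pi r^2h$. Lattice-like cylinder packing related to $\Gamma(t_1^1,t_1^2,N)$: the family $\{\mathcal C^i_\tau(r):\tau\in\Gamma^0\}$ (cut into bounded cylinders of height $h$), where $r>0$ is admissible. Admissible means that the cylinders have pairwise disjoint interiors, equivalently the disks of radius $r$ centred at the points of $\Gamma^0$ form a packing of the Euclidean plane. Its density is $$\frac{\mathrm{Vol}(\mathcal C(r,h))}{\mathrm{Vol}(\mathcal P)}=\frac{\mathrm{Area}(\mathcal C^b(r))}{\mathrm{Area}(\mathcal P^b)}=\frac{\pi r^2}{|t_1^1t_1^2(e^h-e^{-h})|}.$$ The symbol $\approx$ means that the decimal value is given to the displayed accuracy. *)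

(* Defs.v *)
From HB Require Import structures.
From mathcomp Require Import all_boot all_order all_algebra.
From mathcomp Require Import all_classical all_reals all_analysis.

Set Implicit Arguments.
Unset Strict Implicit.
Unset Printing Implicit Defensive.

Import Order.TTheory GRing.Theory Num.Theory.
Import numFieldNormedType.Exports.

Local Open Scope classical_set_scope.
Local Open Scope ring_scope.

Section SolCylinders.
Variable R : realType.

(* Underlying space of Sol; its topology is that of R^3. *)
Notation Sol := (R * R * R)%type.

Definition sol_mul (p q : Sol) : Sol :=
  let: (a, b, c) := p in
  let: (x, y, z) := q in
  (x + a * expR (- z), y + b * expR z, z + c).

(* The invariant Riemannian metric has volume form dx dy dz. *)
Definition Vol (A : set Sol) : \bar R :=
  ((@lebesgue_measure R \x @lebesgue_measure R) \x @lebesgue_measure R)%E A.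

Definition height (N : nat) : R :=
  ln ((N%:R + Num.sqrt (N%:R ^+ 2 - 4)) / 2).

Section Lattice.
Variables (t1 t2 : R) (N : nat).
Let h := height N.

Definition tau1 : Sol := (t1, t2, 0).
Definition tau2 : Sol := (t1 * expR (- h), t2 * expR h, 0).
Definition tau3 : Sol := (0, 0, h).

(* Smallest subset of Sol containing tau1, tau2, tau3 and closed under the
   group operations; the inverse of (a, b, c) is
   (- a e^c, - b e^(-c), - c). *)
Definition sol_inv (p : Sol) : Sol :=
  let: (a, b, c) := p in (- (a * expR c), - (b * expR (- c)), - c).

Inductive Gamma : set Sol :=
| Gamma_tau1 : Gamma tau1
| Gamma_tau2 : Gamma tau2
| Gamma_tau3 : Gamma tau3
| Gamma_mul p q : Gamma p -> Gamma q -> Gamma (sol_mul p q)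
| Gamma_inv p : Gamma p -> Gamma (sol_inv p).

(* Integer combinations for the additive structure of R^3, which agrees with
   sol_mul on the base plane z = 0. *)
Definition Gamma0 : set Sol :=
  [set tau | exists m n : int, tau = tau1 *~ m + tau2 *~ n].

Lemma Gamma0_sub_Gamma : Gamma0 `<=` Gamma.
Proof.
have base (p : Sol) : p.2 = 0 -> Gamma p -> Gamma (- p).
  by case: p => -[a b] c /= -> /Gamma_inv; rewrite /= expR0 oppr0 expR0 !mulr1 -{1}oppr0.
have add (p q : Sol) : p.2 = 0 -> q.2 = 0 -> Gamma p -> Gamma q ->
    Gamma (q + p).
  case: p q => [[a b] c] [[x y] z] /= -> -> gp gq.
  by have := Gamma_mul gp gq; rewrite /= oppr0 expR0 !mulr1.
have zero : Gamma (0 : Sol).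
  rewrite -(addNr tau1); apply: add; [by []|exact: oppr0| |].
    exact: Gamma_tau1.
  by apply: base; last exact: Gamma_tau1.
have mulz2 (p : Sol) (m : int) : p.2 = 0 -> (p *~ m).2 = 0.
  by move=> p0; rewrite (raddfMz (@snd (R * R)%type R)) /= p0 mul0rz.
have muln2 (p : Sol) (n : nat) : p.2 = 0 -> (p *+ n).2 = 0.
  exact: (mulz2 p n).
have mulg (p : Sol) (m : int) : p.2 = 0 -> Gamma p -> Gamma (p *~ m).
  move=> p0 gp.
  have nat_mul n : Gamma (p *+ n).
    elim: n => [//|n IH]; rewrite mulrS.
    by apply: add => //; exact: muln2.
  case: m => n; first exact: nat_mul.
  by apply: base; [exact: muln2 | exact: nat_mul].
move=> _ [m [n ->]]; apply: add.
- exact: mulz2.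
- exact: mulz2.
- exact: mulg Gamma_tau2.
- exact: mulg Gamma_tau1.
Qed.

Definition parallelepiped : set Sol :=
  [set p | 0 <= p.2 <= h /\
     exists u v : R, [/\ 0 <= u <= 1, 0 <= v <= 1 &
       (p.1.1, p.1.2, 0) = u *: tau1 + v *: tau2 :> Sol]].

End Lattice.

Definition inf_cylinder (r : R) : set Sol :=
  [set p | p.1.1 ^+ 2 + p.1.2 ^+ 2 <= r ^+ 2].

Definition inf_cylinder_at (tau : Sol) (r : R) : set Sol :=
  [set sol_mul p tau | p in inf_cylinder r].

Definition cylinder (r h : R) : set Sol :=
  inf_cylinder r `&` [set p | 0 <= p.2 <= h].

Definition admissible (t1 t2 : R) (N : nat) (r : R) : Prop :=
  0 < r /\
  trivIset (Gamma0 t1 t2 N) (fun tau => (inf_cylinder_at tau r)°).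

Definition density (t1 t2 : R) (N : nat) (r : R) : R :=
  fine (Vol (cylinder r (height N))) / fine (Vol (parallelepiped t1 t2 N)).

Definition lattice_densities (t1 t2 : R) (N : nat) : set R :=
  [set density t1 t2 N r | r in admissible t1 t2 N].

Definition is_max (A : set R) (m : R) : Prop := A m /\ ubound A m.

(* As a supremum; that it is a maximum is a separate claim [is_max]. *)
Definition delta (t1 t2 : R) (N : nat) : R := sup (lattice_densities t1 t2 N).

Definition all_densities : set R :=
  [set d | exists t1 t2 : R, exists N : nat,
     [/\ t1 != 0, t2 != 0, (3 <= N)%N & lattice_densities t1 t2 N d]].

(* [sup] returns 0 on a set that is not bounded above, so a positive lower
   bound on [delta_opt] entails that it is a genuine supremum. *)
Definition delta_opt : R := sup all_densities.

(* d is x rounded to k decimals: the error is at most half a unit in the last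
   displayed place. *)
Definition rounds_to (x d : R) (k : nat) : Prop := `|x - d| <= 10 ^- k / 2.

End SolCylinders.

(* Main.v *)
Require Import Defs.
From mathcomp Require Import all_boot all_order all_algebra.
From mathcomp Require Import all_classical all_reals all_analysis.
From mathcomp Require Import measurable_realfun ring lra.

Set Implicit Arguments.
Unset Strict Implicit.
Unset Printing Implicit Defensive.

Import Order.TTheory GRing.Theory Num.Theory.
Import numFieldNormedType.Exports.

Local Open Scope classical_set_scope.
Local Open Scope ring_scope.

(* A lattice packing of cylinders is a packing of disks in the base plane, and
   the factor h cancels in the density.  Disks of radius r centred at Gamma0 have
   disjoint interiors iff every nonzero vector of Gamma0 has squared length at
   least L = 4 r^2, and Hermite's inequality 3 L^2 <= 4 det^2 for plane lattices
   gives the bound pi / sqrt 12.  For t1 = 1, t2 = (sqrt 5 - 1) / 2, N = 3, the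
   lattice Gamma0 is a square lattice, whose best density is pi / 4. *)

(** * Decimal bounds for pi from Machin's formula *)

Section Machin.
Variable R : realType.
Implicit Types (x : R) (n : nat).

Definition atan_sum n x : R :=
  \sum_(k < n) (-1) ^+ k * x ^+ (k.*2.+1) / (k.*2.+1)%:R.

Lemma is_derive_atan_sum n x :
  is_derive x 1 (atan_sum n) (\sum_(k < n) (- x ^+ 2) ^+ k).
Proof.
elim: n => [|n IH].
  rewrite big_ord0 (_ : atan_sum 0 = cst 0); last first.
    by apply/funext => y; rewrite /atan_sum big_ord0.
  exact: is_derive_cst.
rewrite big_ord_recr /= (_ : atan_sum n.+1 = atan_sum n +
    ((-1) ^+ n / (n.*2.+1)%:R) \*: (@id R) ^+ (n.*2.+1)); last first.
  apply/funext => y; rewrite /atan_sum big_ord_recr /= fctE.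
  by rewrite /GRing.scale /= exprfctE mulrAC.
apply: is_deriveD; apply: is_derive_eq => /=.
have n0 : (n.*2.+1)%:R != 0 :> R by rewrite pnatr_eq0.
rewrite /GRing.scale /= mulr1 mulrA divfK //.
by rewrite [in RHS]exprNn -exprM mul2n.
Qed.

(** The derivative of [atan - atan_sum n] is the remainder [(- y ^+ 2) ^+ n / (1 + y ^+ 2)] of a
    geometric series, of sign [(-1) ^+ n]; the mean value theorem passes this sign to the
    difference, which vanishes at 0. Even [n] bounds [atan] from below and odd [n] from above. *)
Lemma atan_sum_alternating n x : 0 <= x ->
  0 <= (-1) ^+ n * (atan x - atan_sum n x).
Proof.
move=> x0.
have D (y : R) : is_derive y 1 (atan - atan_sum n : R -> R)
    ((1 + y ^+ 2)^-1 - \sum_(k < n) (- y ^+ 2) ^+ k).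
  by apply: is_deriveB; exact: is_derive_atan_sum.
have cont : {within `[0, x], continuous (atan - atan_sum n : R -> R)}.
  by apply: derivable_within_continuous => y _; exact: ex_derive.
have [c _] := MVT_segment x0 (fun y _ => D y) cont.
rewrite [X in X = _](_ : _ = atan x - atan_sum n x); last first.
  rewrite !fctE atan0 /atan_sum [X in _ - (_ - X)]big1 ?subr0 // => k _.
  by rewrite expr0n /= mulr0 mul0r.
move=> ->; rewrite subr0 mulrA mulr_ge0 //.
have c1 : 0 < 1 + c ^+ 2 by rewrite ltr_pwDl // sqr_ge0.
have -> : (1 + c ^+ 2)^-1 - \sum_(k < n) (- c ^+ 2) ^+ k =
    (- c ^+ 2) ^+ n / (1 + c ^+ 2).
  apply: (mulIf (lt0r_neq0 c1)); rewrite mulrBl mulVf ?gt_eqF // divfK ?gt_eqF //.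
  by rewrite -[RHS](subrK 1) subrX1; ring.
rewrite mulrA -exprMn mulN1r opprK.
by apply: divr_ge0; [exact: exprn_ge0 (sqr_ge0 c) | exact: ltW].
Qed.

(** Doubling the angle [a] twice gives tangent 120/119, and subtracting [b] gives tangent 1. The
    bounds [0 <= b <= a <= 1 / 5] and [2 <= pi] keep [4 * a - b] where [atan] inverts [tan]. *)
Lemma Machin : pi = 16 * atan (1 / 5) - 4 * atan (1 / 239) :> R.
Proof.
set a := atan _; set b := atan _.
have le5 : a <= 1 / 5.
  have /= := @atan_sum_alternating 1 (1 / 5) ltac:(lra).
  by rewrite /atan_sum big_ord_recr big_ord0 /= -/a double0; lra.
have b0 : 0 <= b by rewrite -(@atan0 R); apply: le_atan; lra.
have ba : b <= a by apply: le_atan; lra.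
have pi2 := @pi_ge2 R.
have cos_neq0 (y : R) : 0 <= y -> y < 1 -> cos y != 0.
  by move=> *; apply/lt0r_neq0/cos_gt0_pihalf; apply/andP; split; lra.
have t1 : tan (a *+ 2) = 5 / 12.
  by rewrite tan_mulr2n ?atanK; [field | apply: cos_neq0; lra].
have t2 : tan (a *+ 2 *+ 2) = 120 / 119.
  by rewrite tan_mulr2n ?t1; [field | apply: cos_neq0; lra].
have a4 : a *+ 2 *+ 2 = 4 * a by ring.
have t3 : tan (a *+ 2 *+ 2 - b) = 1.
  rewrite tanD ?cosN ?tanN ?t2 ?atanK; first by field.
  - by apply: cos_neq0; rewrite a4; lra.
  - by apply: cos_neq0; lra.
have : a *+ 2 *+ 2 - b = pi / 4.
  by rewrite -atan1 -t3 tanK // in_itv /= a4; apply/andP; split; lra.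
by rewrite a4; lra.
Qed.

(** Machin's formula needs a lower bound at 1/5 and an upper bound at 1/239, hence an even and an
    odd number of terms; the upper bound on pi reverses the parities. *)
Lemma pi_gt_decimal : 3 + 1415 / 10 ^+ 4 + 921 / 10 ^+ 7 < pi :> R.
Proof.
have /= := @atan_sum_alternating 6 (1 / 5) ltac:(lra).
have /= := @atan_sum_alternating 1 (1 / 239) ltac:(lra).
by rewrite Machin /atan_sum !big_ord_recr !big_ord0 /= !doubleS double0; lra.
Qed.

Lemma pi_lt_decimal : pi < 3 + 1415 / 10 ^+ 4 + 94 / 10 ^+ 6 :> R.
Proof.
have /= := @atan_sum_alternating 5 (1 / 5) ltac:(lra).
have /= := @atan_sum_alternating 2 (1 / 239) ltac:(lra).
by rewrite Machin /atan_sum !big_ord_recr !big_ord0 /= !doubleS double0; lra.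
Qed.
End Machin.

(** The value 0.90689968... exceeds the lower end 0.9068995 of the rounding interval by less than 2
    / 10^7, so the lower bound on pi and the upper bound on the root are needed to seven
    decimals. *)
Lemma rounds_to_pi_div_sqrt12 (R : realType) :
  rounds_to (pi / Num.sqrt 12 : R) (9069 / 10 ^+ 4) 6.
Proof.
have := @pi_gt_decimal R; have := @pi_lt_decimal R => ub lb.
have s0 : 0 < Num.sqrt 12 :> R by rewrite sqrtr_gt0; lra.
have s2 : Num.sqrt 12 ^+ 2 = 12 :> R by rewrite sqr_sqrtr //; lra.
set s := Num.sqrt _ in s0 s2 *.
have s1 : 3 + 4641 / 10 ^+ 4 + 16 / 10 ^+ 7 < s by nra.
have s3 : s < 3 + 4641 / 10 ^+ 4 + 17 / 10 ^+ 7 by nra.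
rewrite /rounds_to ler_distl; apply/andP; split.
  by rewrite ler_pdivlMr //; lra.
by rewrite ler_pdivrMr //; lra.
Qed.

Lemma rounds_to_pi_div4 (R : realType) :
  rounds_to (pi / 4 : R) (7854 / 10 ^+ 4) 5.
Proof.
have := @pi_gt_decimal R; have := @pi_lt_decimal R => ub lb.
by rewrite /rounds_to ler_distl; apply/andP; split; lra.
Qed.

(** * Hermite's inequality in the plane by Lagrange reduction *)

Section Hermite.
Variable R : realType.

(** With [t = s - k p], Lagrange's identity gives |p|^2 |t|^2 = det^2 + (p.t)^2. Taking for [k] an
    integer nearest to p.s / |p|^2 makes |p.t| at most |p|^2 / 2. *)
Lemma lagrange_step (p1 p2 s1 s2 : R) : 0 < p1 ^+ 2 + p2 ^+ 2 ->
  exists k : int,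
    (p1 ^+ 2 + p2 ^+ 2) * ((s1 - k%:~R * p1) ^+ 2 + (s2 - k%:~R * p2) ^+ 2)
    <= (p1 * s2 - p2 * s1) ^+ 2 + (p1 ^+ 2 + p2 ^+ 2) ^+ 2 / 4.
Proof.
set A := p1 ^+ 2 + p2 ^+ 2 => A0.
pose B := p1 * s1 + p2 * s2.
exists (Num.floor (B / A + 1 / 2)); set k := _%:~R.
have /andP[k1 k2] : k <= B / A + 1 / 2 < k + 1.
  by have := floor_itv (B / A + 1 / 2); rewrite intrD.
have lb : - A <= 2 * (B - k * A).
  have : k * A <= (B / A + 1 / 2) * A by rewrite ler_pM2r.
  by rewrite mulrDl divfK ?gt_eqF //; lra.
have ub : 2 * (B - k * A) <= A.
  have : (B / A + 1 / 2) * A <= (k + 1) * A by rewrite ler_pM2r // ltW.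
  by rewrite mulrDl divfK ?gt_eqF //; lra.
have -> : A * ((s1 - k * p1) ^+ 2 + (s2 - k * p2) ^+ 2) =
    (p1 * s2 - p2 * s1) ^+ 2 + (B - k * A) ^+ 2 by rewrite /A /B; ring.
by rewrite lerD2l; nra.
Qed.

Definition lattice_norms_ge (L p1 p2 s1 s2 : R) := forall m n : int,
  (m, n) != (0, 0) ->
  L <= (p1 * m%:~R + s1 * n%:~R) ^+ 2 + (p2 * m%:~R + s2 * n%:~R) ^+ 2.

Lemma hermite_constant2 (L p1 p2 s1 s2 : R) : 0 < L ->
  lattice_norms_ge L p1 p2 s1 s2 ->
  3 * L ^+ 2 <= 4 * (p1 * s2 - p2 * s1) ^+ 2.
Proof.
move=> L0 min0; rewrite leNgt; apply/negP => lt0.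
set d := (p1 * s2 - p2 * s1) ^+ 2 in lt0.
pose A0 := p1 ^+ 2 + p2 ^+ 2.
have geL q1 q2 r1 r2 : lattice_norms_ge L q1 q2 r1 r2 -> L <= q1 ^+ 2 + q2 ^+ 2.
  by move=> /(_ 1 0 isT); rewrite !mulr1 !mulr0 !addr0.
(* A step from squared length A to T has T <= d / A + A / 4, so A - T >= (3 A^2 - 4 d) / (4 A),
   which is at least [c] because L <= A <= A0. *)
pose c := (3 * L ^+ 2 - 4 * d) / (4 * A0).
have A0L : L <= A0 by exact: geL min0.
have c0 : 0 < c by rewrite divr_gt0; lra.
(* Were the inequality false, each Lagrange reduction step would lower the
   squared length of the first basis vector by at least c. *)
have descent (n : nat) : forall q1 q2 r1 r2 : R,
    (q1 * r2 - q2 * r1) ^+ 2 = d -> lattice_norms_ge L q1 q2 r1 r2 ->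
    q1 ^+ 2 + q2 ^+ 2 <= A0 -> ~ q1 ^+ 2 + q2 ^+ 2 < n%:R * c.
  elim: n => [|n IH] q1 q2 r1 r2 dE minq qA0; have qL := geL _ _ _ _ minq.
    by rewrite mul0r; lra.
  have q0 : 0 < q1 ^+ 2 + q2 ^+ 2 by lra.
  have [k] := lagrange_step r1 r2 q0; rewrite dE.
  set A := q1 ^+ 2 + q2 ^+ 2 in qA0 qL q0 *.
  set t1 := r1 - k%:~R * q1; set t2 := r2 - k%:~R * q2 => step.
  (* The pair (t, q) spans the same lattice: i t + j q = (j - k i) q + i r. *)
  have mint : lattice_norms_ge L t1 t2 q1 q2.
    move=> i j ij; have ij' : (j - k * i, i) != (0, 0).
      apply: contra ij => /eqP[] /[swap] -> /eqP.
      by rewrite mulr0 subr0 => /eqP ->.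
    have := minq _ _ ij'; rewrite intrB intrM /t1 /t2.
    by congr (_ <= _); ring.
  have tL := geL _ _ _ _ mint.
  have dt : (t1 * q2 - t2 * q1) ^+ 2 = d by rewrite -dE /t1 /t2; ring.
  have cA : 4 * c * A <= 3 * L ^+ 2 - 4 * d.
    have -> : 3 * L ^+ 2 - 4 * d = 4 * c * A0.
      by rewrite /c; field; rewrite gt_eqF; lra.
    by rewrite ler_pM2l; lra.
  set T := t1 ^+ 2 + t2 ^+ 2 in step tL *.
  have shrink : T <= A - c.
    rewrite -(ler_pM2l q0).
    have : L ^+ 2 <= A ^+ 2 by rewrite ler_pXn2r // nnegrE; lra.
    by lra.
  move=> lt; apply: (IH _ _ _ _ dt mint).
    by rewrite -/T; lra.
  by rewrite -/T; move: lt; rewrite mulrS mulrDl mul1r; lra.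
have := descent (Num.truncn (A0 / c)).+1 _ _ _ _ erefl min0 (lexx _).
apply; rewrite -/A0 -ltr_pdivrMr //.
by have /andP[] := truncn_itv (divr_ge0 (le_trans (ltW L0) A0L) (ltW c0)).
Qed.
End Hermite.

(** * Areas of the disk and of the parallelogram *)

Section PlaneArea.
Variable R : realType.
Local Notation mu := (@lebesgue_measure R).

(** The substitution x = r sin y, here [F], turns the integrand into 2 r^2 cos^2 y, with primitive
    [P]. *)
Lemma integral_half_circle (r : R) : 0 < r ->
  (\int[mu]_(x in `[(- r)%R, r]) (2 * Num.sqrt (r ^+ 2 - x ^+ 2))%R%:E =
   (pi * r ^+ 2)%R%:E)%E.
Proof.
move=> r0; have pi0 := @pi_gt0 R.
pose F : R -> R := r \*: (@sin R).
pose G (x : R) : R := 2 * Num.sqrt (r ^+ 2 - x ^+ 2).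
pose P : R -> R := (r ^+ 2) \*: ((id : R -> R) + @sin R * @cos R).
have dF x : is_derive (x : R) 1 F (r * cos x) by exact: is_deriveZ.
have F'E : derive1 F = (fun x => r * cos x).
  by apply/funext => x; rewrite derive1E derive_val.
have cF : continuous F.
  by move=> x; apply/differentiable_continuous/derivable1_diffP; exact: ex_derive.
have cF' : continuous (derive1 F).
  by rewrite F'E => x; apply: cvgM; [exact: cvg_cst | exact: continuous_cos].
have cG : continuous G.
  move=> x; apply: cvgM; first exact: cvg_cst.
  apply: (@continuous_comp _ _ _ (fun y : R => r ^+ 2 - y ^+ 2) Num.sqrt);
    last exact: sqrt_continuous.
  by apply: cvgB; [exact: cvg_cst | exact: exprn_continuous].
have dP x : is_derive (x : R) 1 P (2 * r ^+ 2 * cos x ^+ 2).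
  apply: is_derive_eq; rewrite /GRing.scale /=.
  by rewrite mulrN -!expr2 sin2cos2; ring.
have GF (x : R) : - (pi / 2) <= x <= pi / 2 ->
    (G \o F) x * derive1 F x = 2 * r ^+ 2 * cos x ^+ 2.
  move=> xI; rewrite F'E /G /F /= /GRing.scale /=.
  have -> : r ^+ 2 - (r * sin x) ^+ 2 = (r * cos x) ^+ 2.
    by rewrite !exprMn sin2cos2; ring.
  have c0 : 0 <= cos x by exact: cos_ge0_pihalf.
  by rewrite sqrtr_sqr ger0_norm ?mulr_ge0 // ?(ltW r0) //; ring.
have Fr : F (pi / 2) = r by rewrite /F /= sin_pihalf /GRing.scale /= mulr1.
have FNr : F (- (pi / 2)) = - r.
  by rewrite /F /= sinN sin_pihalf /GRing.scale /= mulrN1.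
have lepi : - (pi / 2) < pi / 2 :> R by lra.
transitivity (\int[mu]_(x in `[F (- (pi / 2))%R, F (pi / 2)%R]) (G x)%:E)%E.
  by rewrite Fr FNr.
rewrite (@integration_by_substitution_increasing _ F G); last first.
- exact: continuous_subspaceT.
- split; [by move=> x _; exact: ex_derive | |].
  + exact/cvg_at_right_filter/cF.
  + exact/cvg_at_left_filter/cF.
- by apply/cvg_ex; exists (derive1 F (pi / 2)); exact/cvg_at_left_filter/cF'.
- by apply/cvg_ex; exists (derive1 F (- (pi / 2))); exact/cvg_at_right_filter/cF'.
- by move=> x _; exact: cF'.
- move=> x y xI yI xy; rewrite /F /= /GRing.scale /= ltr_pM2l // ltr_sin //.
- exact: ltW.
transitivity (\int[mu]_(x in `[(- (pi / 2))%R, (pi / 2)%R])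
    (2 * r ^+ 2 * cos x ^+ 2)%R%:E)%E.
  apply: eq_integral => x; rewrite mem_setE in_itv /= => xI.
  by congr (_%:E); exact: GF.
rewrite (@continuous_FTC2 _ _ P) //.
- rewrite -EFinB; congr (_%:E); rewrite /P /= !fctE /GRing.scale /=.
  by rewrite cosN cos_pihalf !mulr0; field.
- apply: continuous_subspaceT => x; apply: cvgM; first exact: cvg_cst.
  by apply: (@continuous_comp _ _ _ (@cos R) (fun y => y ^+ 2));
    [exact: continuous_cos | exact: exprn_continuous].
- have cP : continuous P.
    by move=> x; apply/differentiable_continuous/derivable1_diffP; exact: ex_derive.
  split; [by move=> x _; exact: ex_derive | |].
  + exact/cvg_at_right_filter/cP.
  + exact/cvg_at_left_filter/cP.
- by move=> x _; rewrite derive1E derive_val.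
Qed.

Lemma disk_area (r : R) : 0 < r ->
  (mu \x mu)%E [set p : R * R | p.1 ^+ 2 + p.2 ^+ 2 <= r ^+ 2] = (pi * r ^+ 2)%:E.
Proof.
move=> r0; rewrite /product_measure1.
transitivity (\int[mu]_(x in `[(- r)%R, r]) (2 * Num.sqrt (r ^+ 2 - x ^+ 2))%R%:E)%E.
  rewrite [RHS]integral_mkcond; apply: eq_integral => x _ /=.
  rewrite patchE mem_setE in_itv /=; case: ifPn => xr.
    set s := Num.sqrt _.
    have s2 : s ^+ 2 = r ^+ 2 - x ^+ 2 by rewrite sqr_sqrtr //; nra.
    have s0 : 0 <= s by exact: sqrtr_ge0.
    rewrite (_ : xsection _ _ = `[- s, s]%classic); last first.
      apply/seteqP; split=> y; rewrite /xsection /= inE /= in_itv /=.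
        by move=> h; apply/andP; split; nra.
      by move=> /andP[? ?]; nra.
    (* The section degenerates to a point when [s] is 0, where the interval formula takes its other
       branch. *)
    rewrite lebesgue_measure_itv /= lte_fin -EFinD; case: ifPn => //; last first.
      by move=> h; congr (_%:E); lra.
    by move=> _; congr (_%:E); ring.
  rewrite (_ : xsection _ _ = set0) ?measure0 //.
  apply/seteqP; split=> y //; rewrite /xsection /= inE /= => h.
  by case/negP: xr; apply/andP; split; nra.
exact: integral_half_circle.
Qed.

(** Lebesgue measure is the only measure that gives half-open intervals their length, and the
    pushforward by a shift does so too. *)
Lemma lebesgue_measure_shift (c : R) (A : set R) : measurable A ->
  pushforward mu ((fun x => x + c) : _ -> measurableTypeR R) A = mu A.
Proof.
move=> mA; apply/esym/lebesgue_measure_unique => //=.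
  by apply: measurable_funD.
move=> mf _ [[a b]] _ <-.
rewrite /pushforward (_ : _ @^-1` _ = `]a - c, b - c]%classic); last first.
  by apply/seteqP; split=> x; rewrite /= !in_itv /= ltrBlDr lerBrDr.
rewrite !lebesgue_measure_itv /= !lte_fin ltrD2r; case: ifP => // _.
by rewrite -!EFinD; congr (_%:E); ring.
Qed.

Lemma preimage_affine_unit (a e : R) : a != 0 ->
  [set x | 0 <= (x - e) / a <= 1] = `[e + Num.min 0 a, e + Num.max 0 a]%classic.
Proof.
move=> a0; apply/seteqP; split=> x /=; rewrite in_itv /=.
  case: (ltrgtP a 0) a0 => // a1 _.
    by rewrite ler_ndivrMr // ler_ndivlMr // => /andP[? ?]; apply/andP; split; lra.
  by rewrite ler_pdivrMr // ler_pdivlMr // => /andP[? ?]; apply/andP; split; lra.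
case: (ltrgtP a 0) a0 => // a1 _.
  by rewrite ler_ndivrMr // ler_ndivlMr // => /andP[? ?]; apply/andP; split; lra.
by rewrite ler_pdivrMr // ler_pdivlMr // => /andP[? ?]; apply/andP; split; lra.
Qed.

Lemma lebesgue_measure_affine_unit (a e : R) : a != 0 ->
  mu [set x | 0 <= (x - e) / a <= 1] = `|a|%:E.
Proof.
move=> a0; rewrite preimage_affine_unit // lebesgue_measure_itv /= lte_fin ltrD2l.
rewrite -EFinD; case: (ltrgtP a 0) a0 => // a1 _; rewrite a1.
  by rewrite ltr0_norm //; congr (_%:E); ring.
by rewrite gtr0_norm //; congr (_%:E); ring.
Qed.

Lemma measurable_two_strips (a b c d : R) :
  measurable [set p : measurableTypeR R * measurableTypeR R |
    0 <= a * p.1 + b * p.2 <= 1 /\ 0 <= c * p.1 + d * p.2 <= 1].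
Proof.
have mf (u v : R) : measurable_fun setT
    (fun p : measurableTypeR R * measurableTypeR R => u * p.1 + v * p.2).
  by apply: measurable_funD; apply: measurable_funM.
pose I : set (measurableTypeR R) := `[0, 1]%classic.
have mI : measurable I by exact: measurable_itv.
rewrite [X in measurable X](_ : _ =
    ((fun p => a * p.1 + b * p.2) @^-1` I) `&`
    ((fun p => c * p.1 + d * p.2) @^-1` I)); last first.
  by apply/seteqP; split=> p; rewrite /I /= !in_itv /=.
by apply: measurableI; rewrite -[X in measurable X]setTI; apply: mf.
Qed.

Definition parallelogram (a b c d : R) : set (R * R) :=
  [set p | exists u v : R,
     [/\ 0 <= u <= 1, 0 <= v <= 1, p.1 = u * a + v * c & p.2 = u * b + v * d]].

(** Cramer's rule solves for [u] and [v] as linear forms in the point, so the parallelogram is an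
    intersection of two strips. *)
Lemma measurable_parallelogram (a b c d : R) : a * d - b * c != 0 ->
  measurable (parallelogram a b c d : set (measurableTypeR R * measurableTypeR R)).
Proof.
set D := a * d - b * c => D0.
rewrite (_ : parallelogram a b c d =
    [set p | 0 <= d / D * p.1 + - c / D * p.2 <= 1 /\
             0 <= - b / D * p.1 + a / D * p.2 <= 1]).
  exact: measurable_two_strips.
apply/seteqP; split=> -[x y] /=.
  move=> [u [v []]] /= u01 v01 -> ->.
  have -> : d / D * (u * a + v * c) + - c / D * (u * b + v * d) = u.
    by rewrite /D; field.
  have -> // : - b / D * (u * a + v * c) + a / D * (u * b + v * d) = v.
  by rewrite /D; field.
move=> [u01 v01].
exists (d / D * x + - c / D * y), (- b / D * x + a / D * y); split => //=.
  by rewrite /D; field.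
by rewrite /D; field.
Qed.

(* The shear (x, y) |-> (x, y - (b / a) x) turns the spanned parallelogram into
   one with two horizontal sides, all of whose horizontal sections have length
   |a|. *)
Lemma parallelogram_area (a b c d : R) : a != 0 -> a * d - b * c != 0 ->
  (mu \x mu)%E (parallelogram a b c d) =
  `|a * d - b * c|%:E.
Proof.
set D := a * d - b * c => a0 D0.
(* The sheared parallelogram: the two linear forms are [u] and [v] in terms of x and w = y - (b / a)
   x. *)
pose Q : set (measurableTypeR R * measurableTypeR R) :=
  [set p | 0 <= a^-1 * p.1 + (- (c / D)) * p.2 <= 1 /\ 0 <= 0 * p.1 + (a / D) * p.2 <= 1].
have mQ : measurable Q by exact: measurable_two_strips.
have QE (x w : R) : Q (x, w) <-> (0 <= x / a - c / D * w <= 1 /\ 0 <= a / D * w <= 1).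
  by rewrite /Q /= mul0r add0r mulNr [_ * x]mulrC.
transitivity ((mu \x mu)%E Q).
  (* The shear only translates each vertical section. *)
  apply: eq_integral => x _ /=.
  rewrite -[RHS](@lebesgue_measure_shift (- (b / a * x))); last exact: measurable_xsection.
  congr (mu _); apply/seteqP; split => y; rewrite /xsection /= !inE /= QE.
    move=> [u [v []]] /= u01 v01 -> ->.
    have -> : a / D * (u * b + v * d - b / a * (u * a + v * c)) = v.
      rewrite /D; field.
      by rewrite D0 a0.
    have -> : (u * a + v * c) / a -
        c / D * (u * b + v * d - b / a * (u * a + v * c)) = u.
      rewrite /D; field.
      by rewrite D0 a0.
    by [].
  move=> [u01 v01].
  exists (x / a - c / D * (y - b / a * x)), (a / D * (y - b / a * x)).
  split => //=.
    by field; rewrite D0 a0.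
  by rewrite /D; field; rewrite D0 a0.
(* From here on the integration is over horizontal sections. *)
have -> : (mu \x mu)%E Q = (mu \x^ mu)%E Q.
  apply: product_measure_unique => // A B mA mB; exact: product_measure2E.
(* [t] is the signed height of [Q]. *)
have [t [t0 tE tN]] : exists t,
    [/\ t != 0, forall w, a / D * w = w / t & `|a| * `|t| = `|D|].
  exists (D / a); split; first by rewrite mulf_neq0 ?invr_eq0.
    by move=> w; field; rewrite D0 a0.
  by rewrite -normrM mulrC divfK.
pose J : set R := [set w | 0 <= (w - 0) / t <= 1].
have mJ : measurable (J : set (measurableTypeR R)).
  by rewrite /J preimage_affine_unit.
transitivity (\int[mu]_(w in J) `|a|%:E)%E.
  rewrite [RHS]integral_mkcond; apply: eq_integral => w _ /=.
  rewrite patchE; case: ifPn; rewrite ?notin_setE ?inE => wJ; last first.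
    rewrite (_ : ysection _ _ = set0) ?measure0 //.
    apply/seteqP; split=> x //.
    by rewrite /ysection /= inE QE tE -[w in w / t]subr0 => -[].
  rewrite (_ : ysection _ _ = [set x | 0 <= (x - c / D * w * a) / a <= 1]).
    by rewrite lebesgue_measure_affine_unit.
  move: wJ; rewrite /J /= subr0 => wJ.
  apply/seteqP; split=> x; rewrite /ysection /= inE QE tE mulrBl mulfK //.
  by move=> [].
have muJ : mu J = `|t|%:E by exact: lebesgue_measure_affine_unit.
by rewrite integral_cst //= muJ -EFinM tN.
Qed.
End PlaneArea.

(** * Volumes and the density formula *)

Section Density.
Variable R : realType.
Local Notation mu := (@lebesgue_measure R).
Local Notation rT := (measurableTypeR R).

Lemma Vol_prism (A : set (R * R)) (h : R) :
  measurable (A : set (rT * rT)) -> 0 <= h ->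
  Vol [set p | A p.1 /\ 0 <= p.2 <= h] = ((mu \x mu) A * h%:E)%E.
Proof.
move=> mA h0; pose I : set rT := `[0, h]%classic.
have -> : [set p : R * R * R | A p.1 /\ 0 <= p.2 <= h] = A `*` I.
  by apply/seteqP; split=> p; rewrite /I /= in_itv.
rewrite /Vol product_measure1E //; last exact: measurable_itv.
suff muI : mu I = h%:E by congr (_ * _)%E.
rewrite lebesgue_measure_itv /= lte_fin.
by case: ltgtP h0 => // [_ _|<- _]; rewrite ?oppr0 ?adde0 // -EFinB subr0.
Qed.

Lemma Vol_cylinder (r h : R) : 0 < r -> 0 <= h ->
  Vol (cylinder r h) = (pi * r ^+ 2 * h)%:E.
Proof.
move=> r0 h0; rewrite EFinM -disk_area // -Vol_prism //.
have mf : measurable_fun setT (fun p : rT * rT => p.1 ^+ 2 + p.2 ^+ 2).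
  by apply: measurable_funD; apply: measurable_funX.
rewrite (_ : mkset _ = (fun p => p.1 ^+ 2 + p.2 ^+ 2) @^-1` `]-oo, r ^+ 2]).
  by rewrite -[X in measurable X]setTI; apply: mf.
by apply/seteqP; split=> p; rewrite /= in_itv.
Qed.

Lemma height_gt0 (N : nat) : (3 <= N)%N -> 0 < height R N.
Proof.
move=> N3; apply: ln_gt0; have : 3 <= N%:R :> R by rewrite ler_nat.
by have := sqrtr_ge0 (N%:R ^+ 2 - 4 : R); lra.
Qed.

(** The determinant of [tau1] and [tau2] in the base plane, that is, the signed area of the base
    parallelogram. *)
Definition base_det (t1 t2 : R) (N : nat) : R :=
  t1 * t2 * (expR (height R N) - expR (- height R N)).

Lemma base_det_neq0 (t1 t2 : R) (N : nat) : t1 != 0 -> t2 != 0 -> (3 <= N)%N ->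
  base_det t1 t2 N != 0.
Proof.
move=> t10 t20 /height_gt0 h0; rewrite !mulf_neq0 // subr_eq0 gt_eqF //.
by rewrite ltr_expR; lra.
Qed.

Lemma Vol_parallelepiped (t1 t2 : R) (N : nat) :
  t1 != 0 -> t2 != 0 -> (3 <= N)%N ->
  Vol (parallelepiped t1 t2 N) = (`|base_det t1 t2 N| * height R N)%:E.
Proof.
move=> t10 t20 N3; have h0 := height_gt0 N3.
have D0 := base_det_neq0 t10 t20 N3; have ebd : base_det t1 t2 N =
    t1 * (t2 * expR (height R N)) - t2 * (t1 * expR (- height R N)).
  by rewrite /base_det; ring.
rewrite ebd in D0 *; rewrite EFinM -parallelogram_area //.
rewrite -Vol_prism; [|exact: measurable_parallelogram|exact: ltW].
congr Vol; apply/seteqP; split=> -[[x y] z] /=.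
  by move=> [zI [u [v [u01 v01 [-> -> _]]]]]; split => //; exists u, v.
move=> [[u [v [/= u01 v01 -> ->]]] zI]; split => //; exists u, v; split => //.
by congr (_, _, _); rewrite /= !scaler0 addr0.
Qed.

Lemma densityE (t1 t2 r : R) (N : nat) :
  t1 != 0 -> t2 != 0 -> (3 <= N)%N -> 0 < r ->
  density t1 t2 N r = pi * r ^+ 2 / `|base_det t1 t2 N|.
Proof.
move=> t10 t20 N3 r0; have h0 := height_gt0 N3.
have D0 : `|base_det t1 t2 N| != 0 by rewrite normr_eq0 base_det_neq0.
rewrite /density Vol_cylinder ?Vol_parallelepiped ?(ltW h0) //=.
by field; rewrite D0 gt_eqF.
Qed.
End Density.

(** * Admissible radii, the hexagonal bound and the square lattice *)

Section Packing.
Variable R : realType.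
Local Notation Sol := (R * R * R)%type.

Lemma inf_cylinder_atE (a b r : R) : inf_cylinder_at (a, b, 0) r =
  [set p : Sol | (p.1.1 - a) ^+ 2 + (p.1.2 - b) ^+ 2 <= r ^+ 2].
Proof.
apply/seteqP; split=> [_ [[[x y] z] /= xy <-]|[[x y] z] /= xy].
  by rewrite /= oppr0 expR0 !mulr1 !(addrC _ x, addrC _ y) !addrK.
exists (x - a, y - b, z) => //=.
by rewrite oppr0 expR0 !mulr1 !subrKC add0r.
Qed.

Lemma interior_inf_cylinder_at (a b r : R) : 0 < r ->
  (inf_cylinder_at (a, b, 0) r)° =
  [set p : Sol | (p.1.1 - a) ^+ 2 + (p.1.2 - b) ^+ 2 < r ^+ 2].
Proof.
move=> r0; rewrite inf_cylinder_atE; apply/seteqP; split=> [[[x y] z] /=|p /= pr].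
  rewrite /interior /= => nA.
  (* A horizontal path that moves the point away from the axis by the factor 1 + e. An interior
     point stays in the cylinder for some e > 0, so it cannot lie on the boundary. *)
  pose g (e : R) : Sol := (x + e * (x - a), y + e * (y - b), z).
  have cg : g e @[e --> (0 : R)] --> (x + 0 * (x - a), y + 0 * (y - b), z).
    have cl (u v : R) : u + e * v @[e --> (0 : R)] --> u + 0 * v.
      by apply: cvgD; [exact: cvg_cst | apply: cvgM; [exact: cvg_id | exact: cvg_cst]].
    have cz : z @[_ --> (0 : R)] --> z by exact: cvg_cst.
    exact: (cvg_pair (cvg_pair (cl x (x - a)) (cl y (y - b))) cz).
  have : nbhs (0 : R) (g @^-1` [set p : Sol |
      (p.1.1 - a) ^+ 2 + (p.1.2 - b) ^+ 2 <= r ^+ 2]).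
    by apply: cg; rewrite !mul0r !addr0.
  move=> /nbhs_ballP[e /= e0] /(_ (e / 2)); rewrite /ball /= sub0r normrN.
  rewrite ger0_norm; last lra.
  move=> /(_ ltac:(lra)).
  have -> : (x + e / 2 * (x - a) - a) ^+ 2 + (y + e / 2 * (y - b) - b) ^+ 2 =
      (1 + e / 2) ^+ 2 * ((x - a) ^+ 2 + (y - b) ^+ 2) by field.
  set q := (_ - _) ^+ 2 + _ => h; have r2 : 0 < r ^+ 2 by rewrite exprn_gt0.
  rewrite ltNge; apply/negP => rq.
  have : (1 + e / 2) ^+ 2 * r ^+ 2 <= (1 + e / 2) ^+ 2 * q.
    by rewrite ler_pM2l //; apply: exprn_gt0; lra.
  have := mulr_gt0 e0 r2; have := mulr_ge0 (sqr_ge0 e) (ltW r2).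
  by lra.
have c1 (q : Sol) : u.1.1 @[u --> q] --> q.1.1.
  by apply: (@cvg_comp _ _ _ fst fst _ (nbhs q.1)); exact: cvg_fst.
have c2 (q : Sol) : u.1.2 @[u --> q] --> q.1.2.
  by apply: (@cvg_comp _ _ _ fst snd _ (nbhs q.1)); [exact: cvg_fst | exact: cvg_snd].
pose f (q : Sol) := (q.1.1 - a) * (q.1.1 - a) + (q.1.2 - b) * (q.1.2 - b).
have cf : continuous f.
  move=> q; apply: cvgD; apply: cvgM; apply: cvgB;
    by [exact: c1 | exact: c2 | exact: cvg_cst].
have : nbhs p (f @^-1` [set t | t < r ^+ 2]).
  by apply: cf; apply: open_nbhs_nbhs; split; [exact: open_lt | rewrite /f /= -!expr2].
by apply: filterS => q /=; rewrite /f -!expr2 => /ltW.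
Qed.

Lemma solMz (p : Sol) (m : int) :
  p *~ m = (p.1.1 * m%:~R, p.1.2 * m%:~R, p.2 * m%:~R).
Proof.
rewrite [LHS]surjective_pairing [(p *~ m).1]surjective_pairing.
rewrite (raddfMz (@snd (R * R)%type R)) (raddfMz (@fst (R * R)%type R)).
by rewrite (raddfMz (@snd R R)) (raddfMz (@fst R R)) /= !mulrzr.
Qed.

Lemma Gamma0E (t1 t2 : R) (N : nat) (m n : int) :
  tau1 t1 t2 *~ m + tau2 t1 t2 N *~ n =
  (t1 * m%:~R + t1 * expR (- height R N) * n%:~R,
   t2 * m%:~R + t2 * expR (height R N) * n%:~R, 0) :> Sol.
Proof. by rewrite !solMz /= !mul0r -[RHS]/(_, _, _) -[0 in RHS]addr0. Qed.

(** Two open disks of radius r meet exactly when their centres are less than 2 r apart, and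
    differences of lattice points are lattice points. *)
Lemma admissibleP (t1 t2 r : R) (N : nat) : t1 != 0 -> t2 != 0 -> (3 <= N)%N ->
  admissible t1 t2 N r <-> 0 < r /\
    lattice_norms_ge (4 * r ^+ 2) t1 t2 (t1 * expR (- height R N))
      (t2 * expR (height R N)).
Proof.
move=> t10 t20 N3; have D0 := base_det_neq0 t10 t20 N3.
split=> -[r0 H]; split=> //.
  move=> m n mn; rewrite leNgt; apply: contra mn => lt.
  set x := t1 * _ + _ in lt; set y := t2 * _ + _ in lt.
  have tau0 : Gamma0 t1 t2 N (0, 0, 0).
    by exists 0, 0; rewrite !mulr0z addr0.
  have taumn : Gamma0 t1 t2 N (x, y, 0) by exists m, n; rewrite Gamma0E.
  have : (x, y, 0) = (0, 0, 0) :> Sol.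
    (* The midpoint of the two centres lies in both interiors. *)
    apply: (H _ _ taumn tau0); exists (x / 2, y / 2, 0).
    by rewrite !interior_inf_cylinder_at //; split=> /=; lra.
  case=> x0 y0.
  (* [trivIset] equates only the points; the nonzero determinant then forces both coefficients to
     vanish. *)
  have mD : m%:~R * base_det t1 t2 N = 0.
    rewrite -[RHS](_ : t2 * expR (height R N) * x -
        t1 * expR (- height R N) * y = 0).
      by rewrite /x /y /base_det; ring.
    by rewrite x0 y0; ring.
  have nD : n%:~R * base_det t1 t2 N = 0.
    rewrite -[RHS](_ : t1 * y - t2 * x = 0).
      by rewrite /x /y /base_det; ring.
    by rewrite x0 y0; ring.
  move/eqP: mD; rewrite mulf_eq0 (negPf D0) orbF intr_eq0 => /eqP ->.
  by move/eqP: nD; rewrite mulf_eq0 (negPf D0) orbF intr_eq0 => /eqP ->.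
move=> _ _ [m [n ->]] [m' [n' ->]].
rewrite !Gamma0E => -[[[x y] z] []].
rewrite !interior_inf_cylinder_at //=.
set a := t1 * m%:~R + _; set b := t2 * m%:~R + _.
set a' := t1 * m'%:~R + _; set b' := t2 * m'%:~R + _ => near near'.
have [/eqP[mm nn]|mn] := boolP ((m - m', n - n') == (0, 0)).
  by rewrite /a /b (subr0_eq mm) (subr0_eq nn).
exfalso; have := H _ _ mn; rewrite !intrB.
have -> : t1 * (m%:~R - m'%:~R) + t1 * expR (- height R N) * (n%:~R - n'%:~R) =
  a - a' by rewrite /a /a'; ring.
have -> : t2 * (m%:~R - m'%:~R) + t2 * expR (height R N) * (n%:~R - n'%:~R) =
  b - b' by rewrite /b /b'; ring.
(* By the parallelogram law, the squared distance of the centres is at most twice the sum of the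
   squared distances from the common point to them, hence below 4 r^2. *)
have := sqr_ge0 (x - a + (x - a')); have := sqr_ge0 (y - b + (y - b')).
by lra.
Qed.

Lemma density_le_hexagonal (t1 t2 r : R) (N : nat) :
  t1 != 0 -> t2 != 0 -> (3 <= N)%N -> admissible t1 t2 N r ->
  density t1 t2 N r <= pi / Num.sqrt 12.
Proof.
move=> t10 t20 N3 /admissibleP[] // r0 /hermite_constant2.
have D0 := base_det_neq0 t10 t20 N3.
have r2 : 0 < r ^+ 2 by rewrite exprn_gt0.
rewrite densityE // => /(_ ltac:(lra)).
have -> : t1 * (t2 * expR (height R N)) - t2 * (t1 * expR (- height R N)) =
  base_det t1 t2 N by rewrite /base_det; ring.
rewrite -[_ ^+ 2 in X in _ <= X]real_normK ?num_real // => herm.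
have D1 : 0 < `|base_det t1 t2 N| by rewrite normr_gt0.
have s0 : 0 < Num.sqrt 12 :> R by rewrite sqrtr_gt0; lra.
rewrite -mulrA ler_pM2l ?pi_gt0 // ler_pdivrMr // mulrC ler_pdivlMr //.
(* Hermite's inequality with L = 4 r^2 reads 12 r^4 <= D^2, the square of the goal. *)
rewrite -(@ler_pXn2r _ 2) ?nnegrE ?mulr_ge0 ?(ltW r2) ?(ltW D1) ?(ltW s0)
  ?(ltW r0) //.
by rewrite exprMn sqr_sqrtr; lra.
Qed.

(** The reciprocal of the golden ratio, the positive root of g^2 + g = 1; for N = 3 its square is
    exp(-h). *)
Definition golden : R := - (1 / 2) + Num.sqrt 5 / 2.

Lemma height3_exp : expR (- height R 3) = (3 - Num.sqrt 5) / 2 /\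
  expR (height R 3) = (3 + Num.sqrt 5) / 2.
Proof.
have s2 : Num.sqrt 5 ^+ 2 = 5 :> R by rewrite sqr_sqrtr //; lra.
have s0 : 0 <= Num.sqrt 5 :> R by exact: sqrtr_ge0.
have eh : expR (height R 3) = (3 + Num.sqrt 5) / 2.
  rewrite /height (_ : 3%:R ^+ 2 - 4 = 5); last by ring.
  by rewrite lnK // posrE; lra.
split=> //; rewrite expRN eh.
have h0 : (3 + Num.sqrt 5) / 2 != 0 :> R by rewrite gt_eqF; lra.
by apply: (mulIf h0); rewrite mulVf //; lra.
Qed.

(** The fundamental cell has the area of a square with side [tau1]. *)
Lemma base_det_golden : base_det 1 golden 3 = 1 + golden ^+ 2.
Proof.
have s2 : Num.sqrt 5 ^+ 2 = 5 :> R by rewrite sqr_sqrtr //; lra.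
have [enh eh] := height3_exp.
by rewrite /base_det eh enh /golden; lra.
Qed.

(* tau2 - tau1 is tau1 turned by a right angle, so Gamma0 is a square lattice. *)
Lemma golden_lattice (m n : int) :
  (1 * m%:~R + 1 * expR (- height R 3) * n%:~R) ^+ 2 +
  (golden * m%:~R + golden * expR (height R 3) * n%:~R) ^+ 2 =
  (1 + golden ^+ 2) * ((m + n) ^+ 2 + n ^+ 2)%:~R.
Proof.
have s2 : Num.sqrt 5 ^+ 2 = 5 :> R by rewrite sqr_sqrtr //; lra.
have [-> ->] := height3_exp; rewrite intrD !rmorphXn /= intrD /golden.
set s := Num.sqrt 5 in s2 *; set x := m%:~R; set y := n%:~R.
(* In the orthogonal basis [tau1], [tau2 - tau1] the coefficients are m + n and n; (s - 1) / 2 is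
   [golden]. *)
have -> : 1 * x + 1 * ((3 - s) / 2) * y = (x + y) - (s - 1) / 2 * y by field.
have -> : (- (1 / 2) + s / 2) * x + (- (1 / 2) + s / 2) * ((3 + s) / 2) * y =
    (s - 1) / 2 * (x + y) + y + (s ^+ 2 - 5) / 4 * y by field.
by rewrite s2; field.
Qed.

(** In a square lattice the squared minimal length equals the cell area, so 4 r^2 is at most that
    area, with equality when r is half the length of [tau1]. *)
Lemma lattice_densities_golden :
  lattice_densities 1 golden 3 (pi / 4) /\
  ubound (lattice_densities 1 golden 3) (pi / 4 : R).
Proof.
have s2 : Num.sqrt 5 ^+ 2 = 5 :> R by rewrite sqr_sqrtr //; lra.
have s1 : 1 < Num.sqrt 5 :> R by have := sqrtr_ge0 (5 : R); nra.
have g0 : golden != 0 by rewrite gt_eqF // /golden; lra.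
have S0 : 0 < 1 + golden ^+ 2 by rewrite ltr_pwDl // sqr_ge0.
have one0 : 1 != 0 :> R by exact: oner_neq0.
have D : `|base_det 1 golden 3| = 1 + golden ^+ 2.
  by rewrite base_det_golden gtr0_norm.
split; last first.
  move=> _ [r adm <-]; have [r0 norms] := (admissibleP r one0 g0 (leqnn 3)).1 adm.
  rewrite densityE // D -mulrA ler_pM2l ?pi_gt0 // ler_pdivrMr //.
  have := norms 1 0 isT; rewrite golden_lattice.
  by rewrite (_ : (1 + 0) ^+ 2 + 0 ^+ 2 = 1 :> int) // mulr1; lra.
pose r := Num.sqrt (1 + golden ^+ 2) / 2.
have r0 : 0 < r by rewrite divr_gt0 // sqrtr_gt0.
have r2 : 4 * r ^+ 2 = 1 + golden ^+ 2.
  by rewrite expr_div_n sqr_sqrtr ?(ltW S0) //; field.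
exists r; last first.
  by rewrite densityE // D -r2; field; rewrite gt_eqF.
apply/admissibleP => //; split=> // m n mn.
(* It remains that an integer sum of two squares is at least 1 unless both terms vanish. *)
rewrite golden_lattice r2 ler_pMr // -[1]/(1%:~R) ler_int.
rewrite -gtz0_ge1 lt_neqAle addr_ge0 ?sqr_ge0 // andbT eq_sym.
rewrite paddr_eq0 ?sqr_ge0 // !expf_eq0 /=.
by apply: contra mn => /andP[+ /eqP n0]; rewrite n0 addr0 => /eqP ->.
Qed.

Lemma all_densities_bounded : ubound (@all_densities R) (pi / Num.sqrt 12).
Proof.
move=> d [t1 [t2 [N [t10 t20 N3 [r adm <-]]]]].
exact: density_le_hexagonal.
Qed.
End Packing.

Theorem theorem4p12 (R : realType) :
  let t2 : R := - (1 / 2) + Num.sqrt 5 / 2 in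
  let d : R := - ((- 5 + Num.sqrt 5) * pi * Num.sqrt 5 /
                  (20 * Num.sqrt 5 - 20)) in
  [/\ rounds_to (pi / Num.sqrt 12 : R) (9069 / 10 ^+ 4) 6,
      pi / Num.sqrt 12 >= delta_opt R,
      delta_opt R >= delta 1 t2 3,
      is_max (lattice_densities 1 t2 3) (delta 1 t2 3) /\ delta 1 t2 3 = d
    & rounds_to d (7854 / 10 ^+ 4) 5].
Proof.
move=> t2 d.
have s2 : Num.sqrt 5 ^+ 2 = 5 :> R by rewrite sqr_sqrtr //; lra.
have s1 : 1 < Num.sqrt 5 :> R by have := sqrtr_ge0 (5 : R); nra.
(* With s = sqrt 5 and s^2 = 5, (-5 + s) s = 5 - 5 s = -(20 s - 20) / 4. *)
have dE : d = pi / 4.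
  rewrite /d (_ : (- 5 + Num.sqrt 5) * pi * Num.sqrt 5 =
    - (pi / 4) * (20 * Num.sqrt 5 - 20)); last first.
    rewrite (_ : (- 5 + Num.sqrt 5) * pi * Num.sqrt 5 =
      pi * (Num.sqrt 5 ^+ 2 - 5 * Num.sqrt 5)); last by ring.
    by rewrite s2; field.
  by rewrite mulfK ?opprK // gt_eqF; lra.
have [mem ub] := @lattice_densities_golden R.
have mem_all : @all_densities R (pi / 4).
  exists 1, t2, 3; split => //.
  by rewrite gt_eqF // /t2; lra.
have deltaE : delta 1 t2 3 = pi / 4.
  apply/eqP; rewrite eq_le; apply/andP; split.
    by apply: ge_sup => //; exists (pi / 4).
  by apply: ub_le_sup => //; exists (pi / 4).
rewrite deltaE dE; split=> //.
- exact: rounds_to_pi_div_sqrt12.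
- by apply: ge_sup; [exists (pi / 4) | exact: all_densities_bounded].
(* The hexagonal bound also ensures that [delta_opt] is a genuine supremum, not the default value of
   [sup]. *)
- by apply: ub_le_sup => //; exists (pi / Num.sqrt 12); exact: all_densities_bounded.
- exact: rounds_to_pi_div4.
Qed.
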